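(* Let $A$ and $B$ be trapezoids of height $1$, all of whose bases are parallel to one fixed line, each having both angles at its larger base equal to $45^\circ$. Let $a$ and $b$ be the lengths of the midlines of $A$ and $B$ respectively, and suppose $a\in\mathbb{Q}$. Then $B$ can be tiled by trapezoids homothetic to $A$ if and only if $b\in\mathbb{Q}$.
   Context: A trapezoid is a quadrilateral with exactly one pair of parallel sides; these parallel sides are its bases, and its midline has length equal to half the sum of the lengths of the bases. A figure is homothetic to $A$ if it is the image of $A$ under a map $z\mapsto \lambda z+v$ of the plane with real $\lambda\neq 0$ (negative $\lambda$ allowed) and $v\in\mathbb{R}^2$. A tiling of a figure is a representation of it as a finite union of figures (tiles) with pairwise disjoint interiors. *)

(* Defs.v *)
From HB Require Import structures.
From mathcomp Require Import all_boot all_order all_algebra.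
From mathcomp Require Import all_classical all_reals all_analysis.

Set Implicit Arguments.
Unset Strict Implicit.
Unset Printing Implicit Defensive.

Import Order.TTheory GRing.Theory Num.Theory.
Import numFieldNormedType.Exports.

Local Open Scope classical_set_scope.
Local Open Scope ring_scope.

Section Plane.
Context {R : realType}.
Implicit Types (u v x y : R * R) (A B T : set (R * R)).

Definition dot u v : R := u.1 * v.1 + u.2 * v.2.

Definition cross u v : R := u.1 * v.2 - u.2 * v.1.

(* The Euclidean length; the norm `|u| on R * R is the sup norm. *)
Definition length u : R := Num.sqrt (dot u u).

Definition parallel u v : Prop := cross u v = 0.

Definition angle u v : R := acos (dot u v / (length u * length v)).

Definition line x y : set (R * R) := [set x + t *: (y - x) | t in [set: R]].

Definition dist A B : R := inf [set length (x - y) | x in A & y in B].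

End Plane.

Section Quadrilateral.
Context {R : realType}.
(* The vertices in cyclic order. Indices are taken modulo 4, via the ring
   structure of 'I_4. *)
Implicit Type p : 'I_4 -> R * R.

Definition side p (i : 'I_4) : R * R := p (i + 1) - p i.

(* The vertices are in strictly convex position, in this cyclic order: all four
   turns are strict and go the same way. (As the four exterior angles are less
   than pi, they then sum to 2 pi, so the boundary does not cross itself.) *)
Definition convex_quad p : Prop :=
  forall i j, 0 < cross (side p i) (side p (i + 1)) *
                  cross (side p j) (side p (j + 1)).

(* The closed region bounded by a convex quadrilateral. *)
Definition region p : set (R * R) :=
  [set \sum_i t i *: p i | t in
     [set t : 'I_4 -> R | (forall i, 0 <= t i) /\ \sum_i t i = 1]].

(* A quadrilateral with exactly one pair of parallel sides, its vertices being
   numbered so that p 0 p 1 is its larger base and p 2 p 3 its smaller one; any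
   trapezoid can be so numbered. Convexity is no restriction: a simple
   quadrilateral with two parallel sides is convex, and parallel sides are
   opposite. *)
Definition trapezoid p : Prop :=
  [/\ convex_quad p,
      parallel (side p 0) (side p 2),
      ~ parallel (side p 1) (side p 3) &
      length (side p 2) < length (side p 0)].

Definition height p : R := dist (line (p 0) (p 1)) (line (p 2) (p 3)).

Definition midline p : R := (length (side p 0) + length (side p 2)) / 2.

Definition vertex_angle p (i : 'I_4) : R :=
  angle (p (i + 1) - p i) (p (i - 1) - p i).

End Quadrilateral.

Section Tiling.
Context {R : realType}.
Implicit Types A B T : set (R * R).

Definition homothetic A T : Prop :=
  exists (lambda : R) (v : R * R),
    lambda != 0 /\ T = [set lambda *: z + v | z in A].

Definition tiling B n (T : 'I_n -> set (R * R)) : Prop :=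
  B = \bigcup_i T i /\ trivIset [set: 'I_n] (fun i => interior (T i)).

Definition tileable_by_homothets A B : Prop :=
  exists n (T : 'I_n -> set (R * R)),
    tiling B T /\ forall i, homothetic A (T i).

End Tiling.

(* Main.v *)
Require Import Defs.
From mathcomp Require Import all_boot all_order all_algebra.
From mathcomp Require Import all_classical all_reals all_analysis.
From mathcomp Require Import ring lra.

Import Order.TTheory GRing.Theory Num.Theory.
Import numFieldNormedType.Exports.

Local Open Scope classical_set_scope.
Local Open Scope ring_scope.

Set Implicit Arguments.
Unset Strict Implicit.

(** Everything is moved to a standard position in which both trapezoids, and all
    their homothets, are sets [trap c m h s]: centre [c], midline [m], height [h],
    larger base below ([s = 1]) or above ([s = -1]). The hypotheses on bases,
    height and angles imply that the region of a trapezoid is the image of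
    [trap 0 a 1 s], with [s = 1] or [s = -1] and [a > 1], under a rotation
    followed by a translation ([region_trap]), and the rotation depends on the
    common direction of the bases only.

    If a tiling exists then [b] is rational. Let [f] be an additive function on
    the reals. Replacing the area [m * h] of a trapezoid by [f m * f h] gives a
    quantity that is still additive under tilings ([valuation_additive]). If [b]
    were irrational, [f] could be chosen linear over the rationals with [f 1 = 1]
    and [f b = -1] ([separating_functional]); then the tiled trapezoid gets the
    value [f b * f 1 = -1], whereas a tile of height [h] gets
    [f (h * a) * f h = a * f h ^+ 2], which is nonnegative because [a] is rational
    and positive: a contradiction ([rational_of_tileable]).

    Additivity is proved by slicing. At all but finitely many heights the
    horizontal slice of the large trapezoid is cut by the slices of the tiles, so
    the lengths of these add up ([tiling_slices]). Between two consecutive heights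
    of vertices each trapezoid is cut to a thinner one (or to nothing), whose
    midline is its slice at the middle height, and its value telescopes: it is the
    increment of a function of the height alone ([primitive_increment]). The slope
    of 45 degrees enters here, as it makes the length of a slice an affine function
    of the height with integer linear coefficient, which commutes with [f].

    If [b] is rational then a tiling exists. A copy of the tile and an upside-down
    copy form a parallelogram ([tiles_para_base]), so all parallelograms with the
    same angles and with a commensurable ratio of width to height are tiled by
    grids ([tiles_para_commensurable]). Hence so is a trapezoid at least as
    elongated as the tile, with rational ratio of midline to height, as a scaled
    tile plus such a parallelogram ([tiles_upright_rational]). Thin horizontal
    strips of any trapezoid are that elongated, so finally the large trapezoid is
    cut into equal strips ([tiles_upright_unit]). *)

(** * A rational-linear functional separating an irrational number from 1 *)

(** Take a rational subspace [H] of the reals that is maximal among those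
    containing [b + 1] but not [1]. By maximality [H] is a complement of the
    rationals, and [f] is the projection to the rationals along [H]. *)
Lemma separating_functional (R : realType) (b : R) : ~ rational b ->
  exists f : R -> R, [/\ forall x y, f (x + y) = f x + f y,
    forall q x, f (ratr q * x) = ratr q * f x, f 1 = 1 & f b = -1].
Proof.
move=> b_irr.
pose subQ (H : set R) := (forall x y, H x -> H y -> H (x + y)) /\
  (forall q x, H x -> H (ratr q * x)).
(* The empty set is allowed because the union of an empty chain is empty. *)
pose P (H : set R) := H = set0 \/ [/\ subQ H, H (b + 1) & ~ H 1].
have [F FP totF|H [PH maxH]] := @Zorn_bigcup R P.
  have [[X FX X0]|F0] := pselect (exists2 X, F X & X !=set0); last first.
    left; rewrite -subset0 => x [X FX Xx].
    by apply: F0; exists X => //; exists x.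
  have FP' Y x : F Y -> Y x -> [/\ subQ Y, Y (b + 1) & ~ Y 1].
    by move=> /FP [->|].
  case: X0 => x0 Xx0; right; split; first split.
  - move=> x y [Y FY Yx] [Z FZ Zy].
    have [YZ|ZY] := totF _ _ FY FZ.
    + by exists Z => //; have [[+ _] _ _] := FP' _ _ FZ Zy; apply=> //; exact: YZ.
    + by exists Y => //; have [[+ _] _ _] := FP' _ _ FY Yx; apply=> //; exact: ZY.
  - move=> q x [Y FY Yx]; exists Y => //.
    by have [[_ +] _ _] := FP' _ _ FY Yx; apply.
  - by exists X => //; have [] := FP' _ _ FX Xx0.
  - by move=> [Y FY Y1]; have [] := FP' _ _ FY Y1.
have {PH} [[HD HZ] Hb H1] : [/\ subQ H, H (b + 1) & ~ H 1].
  case: PH => // H0; exfalso.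
  (* The line spanned by [b + 1] shows that the empty set is not maximal. *)
  apply: (maxH [set ratr q * (b + 1) | q in [set: rat]]).
    rewrite H0; split; first by [].
    by move=> /(_ (b + 1)); apply; exists 1 => //; rewrite rmorph1 mul1r.
  right; split; first split.
  - by move=> _ _ [q _ <-] [r _ <-]; exists (q + r) => //; rewrite rmorphD mulrDl.
  - by move=> q _ [r _ <-]; exists (q * r) => //; rewrite rmorphM mulrA.
  - by exists 1 => //; rewrite rmorph1 mul1r.
  - move=> [q _ qb]; apply: b_irr; exists (q^-1 - 1) => //.
    have q0 : ratr q != 0 :> R.
      by apply/eqP => q0; move: qb; rewrite q0 mul0r => /esym/eqP; rewrite oner_eq0.
    rewrite rmorphB rmorph1 fmorphV; apply: (mulfI q0).
    by rewrite mulrBr mulfV // mulr1 -qb; ring.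
have HN x : H x -> H (- x).
  by move=> /(HZ (-1)); rewrite rmorphN rmorph1 mulN1r.
have H0 : H 0 by rewrite -(subrr (b + 1)); apply: HD => //; exact: HN.
have exq x : exists q, H (x - ratr q).
  have [Hx|nHx] := pselect (H x); first by exists 0; rewrite rmorph0 subr0.
  have [h Hh [c hc]] : exists2 h, H h & exists c, 1 = h + ratr c * x.
    apply: contrapT => no.
    (* Otherwise the span of [H] and [x] would be a larger admissible set. *)
    apply: (maxH [set y | exists2 h, H h & exists c, y = h + ratr c * x]).
      split.
        by move=> y Hy; exists y => //; exists 0; rewrite rmorph0 mul0r addr0.
      move=> /(_ x); apply: contra_not nHx; apply.
      by exists 0 => //; exists 1; rewrite rmorph1 mul1r add0r.
    right; split => //; first split.
    - move=> _ _ [h Hh [c ->]] [k Hk [d ->]]; exists (h + k); first exact: HD.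
      by exists (c + d); rewrite rmorphD; ring.
    - move=> q _ [h Hh [c ->]]; exists (ratr q * h); first exact: HZ.
      by exists (q * c); rewrite rmorphM; ring.
    - by exists (b + 1) => //; exists 0; rewrite rmorph0 mul0r addr0.
  have c0 : ratr c != 0 :> R.
    by apply/eqP => c0; apply: H1; rewrite hc c0 mul0r addr0.
  exists c^-1; have -> : x - ratr c^-1 = ratr (- c^-1) * h; last exact: HZ.
  rewrite rmorphN /= fmorphV; apply: (mulfI c0).
  by rewrite mulrBr mulfV // mulNr mulrN mulrA mulfV // mul1r hc; ring.
have uniq_q x q r : H (x - ratr q) -> H (x - ratr r) -> q = r.
  move=> Hq Hr; apply: contrapT => /eqP qr; apply: H1.
  have qr0 : q - r != 0 by rewrite subr_eq0.
  have -> : 1 = ratr (q - r)^-1 * ((x - ratr r) - (x - ratr q)) :> R.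
    have -> : (x - ratr r) - (x - ratr q) = ratr (q - r) by rewrite rmorphB; ring.
    by rewrite -rmorphM mulVf // rmorph1.
  by apply: HZ; apply: HD => //; exact: HN.
pose g x := sval (cid (exq x)).
have Hg x : H (x - ratr (g x)) by rewrite /g; case: cid.
exists (fun x => ratr (g x)); split.
- move=> x y; rewrite -rmorphD; congr ratr.
  apply: uniq_q (Hg (x + y)) _; rewrite rmorphD.
  have -> : x + y - (ratr (g x) + ratr (g y)) =
    (x - ratr (g x)) + (y - ratr (g y)) by ring.
  exact: HD.
- move=> q x; rewrite -rmorphM; congr ratr.
  by apply: uniq_q (Hg _) _; rewrite rmorphM -mulrBr; exact: HZ.
- rewrite -[RHS](rmorph1 ratr); congr ratr; apply: uniq_q (Hg _) _.
  by rewrite rmorph1 subrr.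
- have -> : -1 = ratr (-1) :> R by rewrite rmorphN rmorph1.
  by congr ratr; apply: uniq_q (Hg _) _; rewrite rmorphN rmorph1 opprK.
Qed.

(** * Horizontal slices of a tiling *)

(** Compare Lebesgue measures: the open intervals are disjoint in the closed interval
    from [l0] to [r0], and the closed ones, of the same lengths, cover the open one. *)
Lemma sum_lengths (R : realType) n (l r : 'I_n -> R) (l0 r0 : R) :
  l0 <= r0 -> (forall i, l i <= r i) ->
  trivIset setT (fun i => `]l i, r i[%classic) ->
  (forall i, `]l i, r i[ `<=` `[l0, r0]) ->
  `]l0, r0[ `<=` \bigcup_i `[l i, r i]%classic ->
  r0 - l0 = \sum_i (r i - l i).
Proof.
move=> lr0 lr triv sub cover.
have len b0 b1 (x y : R) : x <= y -> lebesgue_measure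
    ([set` Interval (BSide b0 x) (BSide b1 y)] : set R) = (y - x)%:E.
  rewrite lebesgue_measure_itv /= lte_fin le_eqVlt => /orP[/eqP ->|->] //.
  by rewrite ltxx subrr.
have fsumE (F : 'I_n -> \bar R) :
    \sum_(i \in [set: 'I_n]) F i = (\sum_i F i)%E.
  rewrite (fsbigE (index_enum 'I_n)) ?index_enum_uniq //.
    by apply: eq_bigl => i; rewrite in_setT.
  by move=> i _; rewrite mem_index_enum.
apply/eqP; rewrite eq_le; apply/andP; split; rewrite -lee_fin -sumEFin.
- rewrite -(len false true) // (eq_bigr (fun i => lebesgue_measure
    (`[l i, r i]%classic : set R))); last by move=> i _; rewrite len.
  have := @content_sub_fsum _ _ _ lebesgue_measure 'I_n setT
    (`]l0, r0[%classic : set R) (fun i => `[l i, r i]%classic).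
  rewrite fsumE; apply=> //; exact: finite_finset.
- rewrite -(len true false) // (eq_bigr (fun i => lebesgue_measure
    (`]l i, r i[%classic : set R))); last by move=> i _; rewrite len.
  have := @measure_fin_bigcup _ _ _ lebesgue_measure 'I_n setT
    (fun i => `]l i, r i[%classic).
  rewrite fsumE => <- //; last exact: finite_finset.
  apply: le_measure; rewrite ?inE.
  + by apply: fin_bigcup_measurable;
      [exact: finite_finset|move=> i _; exact: measurable_itv].
  + exact: measurable_itv.
  + by move=> x [i _]; exact: sub.
Qed.

Section Trapezoids.
Context {R : realType}.
Implicit Types (c z : R * R) (m h s x y : R).

Definition trap c m h s : set (R * R) := [set z |
  `|z.2 - c.2| <= h / 2 /\ `|z.1 - c.1| + s * (z.2 - c.2) <= m / 2].

(** The length of the horizontal slice of [trap c m h s] at height [y], for [y]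
    different from the heights of the bases. *)
Definition slice c m h s y : R :=
  if `|y - c.2| < h / 2 then m - 2 * s * (y - c.2) else 0.

Definition is_sign s := s = 1 \/ s = -1.

Lemma continuous_affine (al be ga : R) :
  continuous (fun z : R * R => al * z.1 + be * z.2 + ga).
Proof.
move=> z.
apply: (@continuousD _ _ _ (fun z : R * R => al * z.1 + be * z.2) (cst ga)).
  apply: (@continuousD _ _ _ (fun z : R * R => al * z.1)
    (fun z : R * R => be * z.2)).
    by apply: continuousM; [exact: cst_continuous|exact: cvg_fst].
  by apply: continuousM; [exact: cst_continuous|exact: cvg_snd].
exact: cst_continuous.
Qed.

Lemma trap_interior c m h s z : `|z.2 - c.2| < h / 2 ->
  `|z.1 - c.1| + s * (z.2 - c.2) < m / 2 -> interior (trap c m h s) z.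
Proof.
rewrite !ltr_norml => /andP[h1 h2] h3.
have aff al be ga : al * z.1 + be * z.2 + ga < 0 ->
    \forall w \near z, al * w.1 + be * w.2 + ga < 0.
  move=> lt0; have /= := @continuous_affine al be ga z.
  move=> /cvgr_lt; exact.
have h4 : z.1 - c.1 + s * (z.2 - c.2) < m / 2.
  by apply: le_lt_trans h3; rewrite lerD2r ler_norm.
have h5 : - (z.1 - c.1) + s * (z.2 - c.2) < m / 2.
  by apply: le_lt_trans h3; rewrite lerD2r -normrN ler_norm.
have h1' := aff 0 (-1) (c.2 - h / 2) ltac:(lra).
have h2' := aff 0 1 (- c.2 - h / 2) ltac:(lra).
have h4' := aff 1 s (- c.1 - s * c.2 - m / 2) ltac:(lra).
have h5' := aff (-1) s (c.1 - s * c.2 - m / 2) ltac:(lra).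
rewrite /interior /=; near=> w.
have w1 : 0 * w.1 + -1 * w.2 + (c.2 - h / 2) < 0 by near: w.
have w2 : 0 * w.1 + 1 * w.2 + (- c.2 - h / 2) < 0 by near: w.
have w4 : 1 * w.1 + s * w.2 + (- c.1 - s * c.2 - m / 2) < 0 by near: w.
have w5 : -1 * w.1 + s * w.2 + (c.1 - s * c.2 - m / 2) < 0 by near: w.
split; first by rewrite ler_norml; apply/andP; split; lra.
by rewrite -lerBrDr ler_norml; apply/andP; split; lra.
Unshelve. all: by end_near. Qed.

Lemma slice_ge0 c m h s y : is_sign s -> h <= m -> 0 <= slice c m h s y.
Proof.
rewrite /slice => s1 hm; case: ifP => //; rewrite ltr_norml => /andP[y1 y2].
by case: s1 => ->; lra.
Qed.

Lemma slice_inside c m h s x y :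
  `]c.1 - slice c m h s y / 2, c.1 + slice c m h s y / 2[%classic x ->
  interior (trap c m h s) (x, y).
Proof.
rewrite /= in_itv /= /slice; case: ifP => [yh|_ /andP[]]; last lra.
move=> /andP[x1 x2]; apply: trap_interior => //=.
by rewrite -ltrBrDr ltr_norml; apply/andP; split; lra.
Qed.

Lemma slice_outside c m h s x y : y != c.2 - h / 2 -> y != c.2 + h / 2 ->
  trap c m h s (x, y) ->
  `[c.1 - slice c m h s y / 2, c.1 + slice c m h s y / 2]%classic x.
Proof.
move=> y1 y2 [/= yh xm]; rewrite in_itv /= /slice.
have -> : `|y - c.2| < h / 2.
  rewrite lt_neqAle yh andbT; apply/eqP => yE.
  have [y0|y0] := leP 0 (y - c.2).
    by move: yE; rewrite ger0_norm // => yE; move/eqP: y2; apply; lra.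
  by move: yE; rewrite ltr0_norm // => yE; move/eqP: y1; apply; lra.
move: xm; rewrite -lerBrDr ler_norml => /andP[x1 x2].
by apply/andP; split; lra.
Qed.

(** The open slices of the tiles are disjoint, since they lie in the interiors.
    The heights of the bases are excluded because [slice] vanishes there, although
    the trapezoid has a slice of positive length. *)
Lemma tiling_slices n (c : 'I_n -> R * R) (m h s : 'I_n -> R) c0 m0 h0 s0 y :
  (forall i, is_sign (s i)) -> (forall i, h i <= m i) ->
  is_sign s0 -> h0 <= m0 ->
  tiling (trap c0 m0 h0 s0) (fun i => trap (c i) (m i) (h i) (s i)) ->
  y != c0.2 - h0 / 2 -> y != c0.2 + h0 / 2 ->
  (forall i, y != (c i).2 - h i / 2) -> (forall i, y != (c i).2 + h i / 2) ->
  slice c0 m0 h0 s0 y = \sum_i slice (c i) (m i) (h i) (s i) y.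
Proof.
move=> s1 hm s01 hm0 [TE Ttriv] y1 y2 yi1 yi2.
pose w i := slice (c i) (m i) (h i) (s i) y.
have := @sum_lengths R n (fun i => (c i).1 - w i / 2) (fun i => (c i).1 + w i / 2)
  (c0.1 - slice c0 m0 h0 s0 y / 2) (c0.1 + slice c0 m0 h0 s0 y / 2).
have E (u v : R) : u + v / 2 - (u - v / 2) = v by lra.
rewrite E => ->; first by apply: eq_bigr => i _; rewrite E.
- by have := slice_ge0 c0 y s01 hm0; lra.
- by move=> i; have := slice_ge0 (c i) y (s1 i) (hm i); rewrite /w; lra.
- move=> i j _ _ [x [xi xj]]; apply: Ttriv => //.
  by exists (x, y); split; exact: slice_inside.
- move=> i x /slice_inside/interior_subset xi.
  by apply: slice_outside => //; rewrite TE; exists i.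
- move=> x /slice_inside/interior_subset; rewrite TE => -[i _ xi].
  by exists i => //; exact: slice_outside.
Qed.

End Trapezoids.

(** * A valuation additive under tilings *)

Section Valuation.
Context {R : realType}.
Implicit Types (c z : R * R) (m h s x y : R).

(** Induction on the number of points of [r] strictly between [y] and [y'],
    cutting at any one of them. *)
Lemma eq_across_partition (T : Type) (H : R -> T) (r : seq R) :
  (forall y y', y < y' -> (forall t, t \in r -> ~ (y < t < y')) -> H y = H y') ->
  forall y y', y < y' -> H y = H y'.
Proof.
move=> Hr y y'; have [k] := ubnP (count (fun t => y < t < y') r).
elim: k y y' => // k IH y y' ck yy'.
have [/hasP[t tr /andP[yt ty']]|/hasPn no] :=
  boolP (has (fun t => y < t < y') r); last first.
  by apply: Hr => // t tr; apply/negP; exact: no.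
have lt_count u v : y <= u -> v <= y' -> ~~ (u < t < v) ->
    (count (fun t => (u < t < v)%R) r < k)%N.
  move=> yu vy' tuv; rewrite -ltnS; apply: leq_trans ck.
  rewrite !(permP (perm_to_rem tr)) /= (negPf tuv) yt ty' ltnS.
  apply: sub_count => x /andP[ux xv]; apply/andP; split.
    exact: le_lt_trans ux.
  exact: lt_le_trans vy'.
by rewrite (IH y t) ?(IH t y') //; apply: lt_count; rewrite ?ltxx ?andbF // ltW.
Qed.

Variable f : R -> R.
Hypothesis fD : forall x y, f (x + y) = f x + f y.

Lemma additive0 : f 0 = 0.
Proof. by apply: (addIr (f 0)); rewrite -fD !add0r. Qed.

Lemma additiveN x : f (- x) = - f x.
Proof. by apply: (addIr (f x)); rewrite -fD !addNr additive0. Qed.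

Lemma additiveB x y : f (x - y) = f x - f y.
Proof. by rewrite fD additiveN. Qed.

Lemma additive_sign s x : is_sign s -> f (s * x) = s * f x.
Proof. by case=> ->; rewrite ?mul1r // !mulN1r additiveN. Qed.

Lemma additive_sum (I : Type) (r : seq I) (F : I -> R) :
  f (\sum_(i <- r) F i) = \sum_(i <- r) f (F i).
Proof. exact: (big_morph f fD additive0). Qed.

Definition clamp h t := Num.max (- (h / 2)) (Num.min (h / 2) t).

(** For a suitable constant, the value of the part of [trap c m h s] below height
    [y] is [primitive c m h s y] minus that constant: an antiderivative of
    the function giving the slices, with [f] applied to all factors. *)
Definition primitive c m h s y : R :=
  f m * f (clamp h (y - c.2)) - s * f (clamp h (y - c.2)) ^+ 2.

Lemma clamp_in h t : - (h / 2) <= t -> t <= h / 2 -> clamp h t = t.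
Proof. by move=> t1 t2; rewrite /clamp min_r // max_r. Qed.

Lemma clamp_lo h t : 0 < h -> t <= - (h / 2) -> clamp h t = - (h / 2).
Proof. by move=> h0 ht; rewrite /clamp max_l // ge_min; apply/orP; right. Qed.

Lemma clamp_hi h t : 0 < h -> h / 2 <= t -> clamp h t = h / 2.
Proof. by move=> h0 ht; rewrite /clamp min_l // max_r //; lra. Qed.

(** If both heights are in the range of the trapezoid, write [t] and [t'] for them
    relative to the centre. The slice at the middle has length [m - s * (t + t')],
    and [f (m - s * (t + t')) * f (t' - t)] is
    [f m * (f t' - f t) - s * (f t' ^+ 2 - f t ^+ 2)]. Otherwise both sides
    vanish. *)
Lemma primitive_increment c m h s y y' : is_sign s -> 0 < h -> y < y' ->
  ~ (y < c.2 - h / 2 < y') -> ~ (y < c.2 + h / 2 < y') ->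
  primitive c m h s y' - primitive c m h s y =
  f (slice c m h s ((y + y') / 2)) * f (y' - y).
Proof.
move=> s1 h0 yy' /negP + /negP.
rewrite !negb_and -!leNgt /primitive /slice => lo hi.
case: ifP => [|/negbT]; last first.
  rewrite -leNgt ler_normr => out.
  have -> : clamp h (y' - c.2) = clamp h (y - c.2).
    case/orP: out => out.
      by rewrite !clamp_hi //; case/orP: hi; lra.
    by rewrite !clamp_lo //; case/orP: lo; lra.
  by rewrite subrr additive0 mul0r.
rewrite ltr_norml => /andP[in1 in2].
rewrite !clamp_in; try by case/orP: lo; case/orP: hi; lra.
have -> : y' - y = (y' - c.2) - (y - c.2) by ring.
have -> : m - 2 * s * ((y + y') / 2 - c.2) = m - s * ((y' - c.2) + (y - c.2)).
  by field.
by rewrite !additiveB additive_sign // fD !additiveB; ring.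
Qed.

Lemma primitive_total c m h s y y' : is_sign s -> 0 < h ->
  y <= c.2 - h / 2 -> c.2 + h / 2 <= y' ->
  primitive c m h s y' - primitive c m h s y = f m * f h.
Proof.
move=> s1 h0 yl yh; rewrite /primitive clamp_hi ?clamp_lo //; try lra.
have -> : f h = f (h / 2) + f (h / 2) by rewrite -fD; congr f; field.
by rewrite additiveN; ring.
Qed.

(** The sum of the primitives of the tiles minus that of the tiled trapezoid does
    not change between two heights that are not separated by the height of a base,
    by the additivity of slices. Hence it is constant, and its total increment
    zero. *)
Lemma valuation_additive n (c : 'I_n -> R * R) (m h s : 'I_n -> R) c0 m0 h0 s0 :
  (forall i, is_sign (s i)) -> (forall i, 0 < h i) -> (forall i, h i <= m i) ->
  is_sign s0 -> 0 < h0 -> h0 <= m0 ->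
  tiling (trap c0 m0 h0 s0) (fun i => trap (c i) (m i) (h i) (s i)) ->
  f m0 * f h0 = \sum_i f (m i) * f (h i).
Proof.
move=> s1 hpos hm s01 h0pos hm0 T.
pose H y := \sum_i primitive (c i) (m i) (h i) (s i) y - primitive c0 m0 h0 s0 y.
pose r := [:: c0.2 - h0 / 2, c0.2 + h0 / 2 &
  [seq (c i).2 - h i / 2 | i : 'I_n] ++ [seq (c i).2 + h i / 2 | i : 'I_n]].
have r1 : c0.2 - h0 / 2 \in r by rewrite !inE eqxx.
have r2 : c0.2 + h0 / 2 \in r by rewrite !inE eqxx orbT.
have r3 i : (c i).2 - h i / 2 \in r.
  by rewrite !inE mem_cat (fintype.image_f (fun i => (c i).2 - h i / 2)) // !orbT.
have r4 i : (c i).2 + h i / 2 \in r.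
  by rewrite !inE mem_cat (fintype.image_f (fun i => (c i).2 + h i / 2)) // !orbT.
have HE : forall y y', y < y' -> H y = H y'.
  apply: (@eq_across_partition _ _ r) => y y' yy' yr.
  have mid t : t \in r -> (y + y') / 2 != t.
    move=> /yr yty'; apply/eqP => tE; apply: yty'; rewrite -tE.
    by apply/andP; split; lra.
  have := tiling_slices s1 hm s01 hm0 T (mid _ r1) (mid _ r2)
    (fun i => mid _ (r3 i)) (fun i => mid _ (r4 i)).
  move=> /(congr1 (fun t => f t * f (y' - y))).
  rewrite additive_sum mulr_suml.
  rewrite -(primitive_increment _ s01 h0pos yy' (yr _ r1) (yr _ r2)).
  under eq_bigr => i _ do
    rewrite -(primitive_increment _ (s1 i) (hpos i) yy'
      (yr _ (r3 i)) (yr _ (r4 i))).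
  by rewrite sumrB /H => E; lra.
have [M rM] : exists M, forall t, t \in r -> `|t| < M.
  exists (\sum_(t <- r) `|t| + 1) => t tr.
  by rewrite (big_rem t) //= ltr_pwDr // lerDl sumr_ge0.
have lo t : t \in r -> - M <= t by move=> /rM; rewrite ltr_norml => /andP[/ltW].
have hi t : t \in r -> t <= M by move=> /rM; rewrite ltr_norml => /andP[_ /ltW].
have M0 : - M < M by have := rM _ (mem_head _ _); rewrite ltr_norml => /andP[]; lra.
have := HE _ _ M0; rewrite /H => E.
rewrite -(@primitive_total c0 m0 h0 s0 (- M) M) ?lo ?hi //.
under eq_bigr => i _ do
  rewrite -(@primitive_total (c i) (m i) (h i) (s i) (- M) M) ?lo ?hi //.
by rewrite sumrB; lra.
Qed.

End Valuation.

(** * A tiled trapezoid has rational midline *)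

Section Homothets.
Context {R : realType}.
Implicit Types (c z v : R * R) (m h s x y a b : R).

Lemma trap_scale (k : R) v c m h s z : k != 0 ->
  trap (k *: c + v) (`|k| * m) (`|k| * h) (Num.sg k * s) (k *: z + v) <->
  trap c m h s z.
Proof.
move=> k0; have nk : 0 < `|k| by rewrite normr_gt0.
rewrite /trap /=.
have E (p q r : R) : k * p + r - (k * q + r) = k * (p - q) by ring.
have skx (u : R) : Num.sg k * s * (k * u) = `|k| * (s * u).
  by rewrite [in RHS]normrEsg; ring.
rewrite /GRing.scale /= !E !normrM skx -!mulrA -mulrDr.
by rewrite !ler_pM2l.
Qed.

Lemma homothet_trap (k : R) v c m h s : k != 0 ->
  [set k *: z + v | z in trap c m h s] =
  trap (k *: c + v) (`|k| * m) (`|k| * h) (Num.sg k * s).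
Proof.
move=> k0; apply/seteqP; split=> [_ [z zA <-]|w].
  exact/trap_scale.
have -> : w = k *: (k^-1 *: (w - v)) + v by rewrite scalerA mulfV // scale1r subrK.
by move=> /(trap_scale _ _ _ _ _ _ k0); exists (k^-1 *: (w - v)).
Qed.

Lemma is_sign_sgM (k : R) s : k != 0 -> is_sign s -> is_sign (Num.sg k * s).
Proof.
rewrite /is_sign; case: sgrP => // _ _ [] ->;
  rewrite ?mul1r ?mulN1r ?opprK; by [left|right].
Qed.

Lemma rational_of_tileable a b s s0 : is_sign s -> is_sign s0 -> 1 < a -> 1 < b ->
  rational a -> tileable_by_homothets (trap 0 a 1 s) (trap 0 b 1 s0) -> rational b.
Proof.
move=> s1 s01 a1 b1 [q _ qa] [n [T [T_tiling]]].
move=> /choice[k] /choice[v] kv.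
have k0 i : k i != 0 by have [] := kv i.
have TE : T = fun i => trap (v i) (`|k i| * a) `|k i| (Num.sg (k i) * s).
  apply/funext => i; have [_ ->] := kv i.
  by rewrite homothet_trap ?k0 // scaler0 add0r mulr1.
apply: contrapT => /separating_functional[f [fD fZ f1 fb]].
have kpos i : 0 < `|k i| by rewrite normr_gt0.
have := @valuation_additive R f fD n v (fun i => `|k i| * a) (fun i => `|k i|)
  (fun i => Num.sg (k i) * s) 0 b 1 s0.
rewrite -TE f1 fb mulr1 => /(_ _ _ _ s01 ltr01 (ltW b1) T_tiling) E.
suff: 0 <= -1 :> R by lra.
rewrite E; first last.
- by move=> i; rewrite ler_peMr // ltW.
- by [].
- by move=> i; exact: is_sign_sgM.
apply: sumr_ge0 => i _.
rewrite -qa mulrC [_ * ratr q]mulrC fZ mulrCA -expr2 mulr_ge0 ?sqr_ge0 // qa; lra.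
Qed.

End Homothets.

(** * Cutting along a line *)

Section Cutting.
Context {R : realType}.
Variable A : set (R * R).
Implicit Types (B C D : set (R * R)).

Lemma tileable_tile B : homothetic A B -> tileable_by_homothets A B.
Proof.
move=> AB; exists 1%N, (fun=> B); split=> //; split.
  by apply/seteqP; split=> [z Bz|z [i _ //]]; exists ord0.
by move=> i j _ _ _; rewrite !ord1.
Qed.

(** A point in both interiors lies on the line, but can be moved off it along the
    normal [(al, be)] within [C] and [D]. *)
Lemma interiors_disjoint (al be ga : R) C D : 0 < al ^+ 2 + be ^+ 2 ->
  (forall z, C z -> al * z.1 + be * z.2 <= ga) ->
  (forall z, D z -> ga <= al * z.1 + be * z.2) ->
  forall z, interior C z -> interior D z -> False.
Proof.
move=> pos Cle Dge z Cz Dz.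
have : \forall e \near (0 : R), (C `&` D) (z + e *: (al, be)).
  have : nbhs (z + 0 *: (al, be)) (C `&` D).
    by rewrite scale0r addr0; apply: filterI.
  apply: (@continuousD _ _ _ (cst z) (fun e : R => e *: ((al, be) : R * R)) 0).
    exact: cst_continuous.
  exact: scalel_continuous.
move=> /nbhs_ballP[e /= e0 eCD].
have [/Cle + /Dge] : (C `&` D) (z + (e / 2) *: (al, be)).
  by apply: eCD; rewrite /ball /= sub0r normrN gtr0_norm; lra.
have [zC zD] := (interior_subset Cz, interior_subset Dz).
have := Cle _ zC; have := Dge _ zD.
rewrite !/GRing.scale /= !/GRing.scale /= => z1 z2 w1 w2.
have : 0 < e / 2 * (al ^+ 2 + be ^+ 2) by rewrite mulr_gt0 //; lra.
by nra.
Qed.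

Lemma tileable_cut (al be ga : R) B C D : 0 < al ^+ 2 + be ^+ 2 ->
  (forall z, C z <-> B z /\ al * z.1 + be * z.2 <= ga) ->
  (forall z, D z <-> B z /\ ga <= al * z.1 + be * z.2) ->
  tileable_by_homothets A C -> tileable_by_homothets A D ->
  tileable_by_homothets A B.
Proof.
move=> pos CE DE [n1 [T1 [[C1 triv1] hom1]]] [n2 [T2 [[D2 triv2] hom2]]].
have disj := interiors_disjoint pos (fun z Cz => proj2 (proj1 (CE z) Cz))
  (fun z Dz => proj2 (proj1 (DE z) Dz)).
have T1C i : interior (T1 i) `<=` interior C.
  by apply: interiorS; rewrite C1 => z Tz; exists i.
have T2D i : interior (T2 i) `<=` interior D.
  by apply: interiorS; rewrite D2 => z Tz; exists i.
exists (n1 + n2)%N, (fun i : 'I_(n1 + n2) =>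
  match fintype.split i with inl j => T1 j | inr j => T2 j end).
split; last by move=> i; case: (fintype.split i).
split.
- apply/seteqP; split=> z.
  + move=> Bz; have [le|/ltW ge] := leP (al * z.1 + be * z.2) ga.
      have : C z by exact/CE.
      rewrite C1 => -[i _ Tz].
      by exists (lshift n2 i); rewrite // (unsplitK (inl i)).
    have : D z by exact/DE.
    rewrite D2 => -[i _ Tz].
    by exists (rshift n1 i); rewrite // (unsplitK (inr i)).
  + move=> [i _]; case: (fintype.split i) => j Tz.
      suff: C z by move=> /CE[].
      by rewrite C1; exists j.
    suff: D z by move=> /DE[].
    by rewrite D2; exists j.
- move=> i j _ _; rewrite -{2}(splitK i) -{2}(splitK j).
  case: (fintype.split i) => i'; case: (fintype.split j) => j' [z [zi zj]].
  + by congr (unsplit (inl _)); apply: triv1 => //; exists z.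
  + by case: (disj z (T1C _ _ zi) (T2D _ _ zj)).
  + by case: (disj z (T1C _ _ zj) (T2D _ _ zi)).
  + by congr (unsplit (inr _)); apply: triv2 => //; exists z.
Qed.

End Cutting.

(** * Construction of a tiling when the midline is rational *)

Section Construction.
Context {R : realType}.
Variables (a s : R).
Hypothesis a1 : 1 < a.
Hypothesis s1 : is_sign s.
Local Notation A := (trap (0 : R * R) a 1 s).
Local Notation tileable := (tileable_by_homothets A).
Implicit Types (x y w h m : R).

(** In [upright] and [para] the point [(x, y)] is the lower left vertex. *)
Definition upright x y m h : set (R * R) := [set z |
  0 <= z.2 - y <= h /\ x + (z.2 - y) <= z.1 <= x + m + h - (z.2 - y)].

Definition para x y w h : set (R * R) := [set z |
  0 <= z.2 - y <= h /\ x + (z.2 - y) <= z.1 <= x + w + (z.2 - y)].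

Definition tiles_upright m h := forall x y, tileable (upright x y m h).
Definition tiles_para w h := forall x y, tileable (para x y w h).

(** For pieces cut out of a figure by a line, all given by affine inequalities. *)
Local Ltac cut_by_line :=
  move=> z; rewrite /upright /para /trap /= -?[_ + -1 * _ <= _]lerBrDr ?ler_norml;
  split; [move=> [/andP[? ?] /andP[? ?]]; split; [split|];
            try (apply/andP; split); lra
         |move=> [[/andP[? ?] /andP[? ?]] ?]; split; apply/andP; split; lra].

Lemma uprightE x y m h :
  upright x y m h = trap (x + (m + h) / 2, y + h / 2) m h 1.
Proof.
apply/seteqP; split=> z;
  rewrite /upright /trap /= -[_ + 1 * _ <= _]lerBrDr !ler_norml.
  by move=> [/andP[? ?] /andP[? ?]]; split; apply/andP; split; lra.
by move=> [/andP[? ?] /andP[? ?]]; split; apply/andP; split; lra.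
Qed.

(** Both orientations occur, as the factor of a homothety may be negative. *)
Lemma tileable_homothet c h s' : is_sign s' -> 0 < h ->
  tileable (trap c (h * a) h s').
Proof.
move=> s'1 h0; apply: tileable_tile; exists (s * s' * h), c.
have ss : s * s' = 1 \/ s * s' = -1.
  by case: s1 => ->; case: s'1 => ->; rewrite ?mulrNN ?mulr1 ?mul1r;
    [left|right|right|left].
have nss : `|s * s' * h| = h.
  by rewrite normrM (gtr0_norm h0); case: ss => ->; rewrite ?normrN normr1 mul1r.
have ss0 : s * s' * h != 0 by rewrite -normr_gt0 nss.
split=> //; rewrite homothet_trap // scaler0 add0r nss mulr1; congr trap.
rewrite sgrM (gtr0_sg h0) mulr1.
by case: s1 => ->; case: s'1 => ->;
  rewrite ?mulrNN ?mulr1 ?mul1r ?sgrN ?sgr1 ?mulrNN ?mul1r.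
Qed.

Lemma tiles_upright_base h : 0 < h -> tiles_upright (h * a) h.
Proof.
by move=> h0 x y; rewrite uprightE; apply: tileable_homothet => //; left.
Qed.

(** Two copies of the tile, one of them upside down, share a slanted side. *)
Lemma tiles_para_base h : 0 < h -> tiles_para (2 * a * h) h.
Proof.
move=> h0 x y.
have ha : h < h * a by rewrite ltr_pMr.
apply: (@tileable_cut _ _ 1 1 (x + y + h * a + h) _ (upright x y (h * a) h)
  (trap (x + (3 * a * h + h) / 2, y + h / 2) (h * a) h (-1))).
- by rewrite !expr1n addr_gt0.
- by cut_by_line.
- by cut_by_line.
- exact: tiles_upright_base.
- by apply: tileable_homothet => //; right.
Qed.

Lemma tiles_para_addw w w' h : 0 < w -> 0 < w' ->
  tiles_para w h -> tiles_para w' h -> tiles_para (w + w') h.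
Proof.
move=> w0 w'0 Pw Pw' x y.
apply: (@tileable_cut _ _ 1 (-1) (x + w - y) _ (para x y w h)
  (para (x + w) y w' h)) => //.
- by rewrite sqrrN !expr1n addr_gt0.
- by cut_by_line.
- by cut_by_line.
Qed.

Lemma tiles_para_addh w h h' : 0 < h -> 0 < h' ->
  tiles_para w h -> tiles_para w h' -> tiles_para w (h + h').
Proof.
move=> h0 h'0 Ph Ph' x y.
apply: (@tileable_cut _ _ 0 1 (y + h) _ (para x y w h)
  (para (x + h) (y + h) w h')) => //.
- by cut_by_line.
- by cut_by_line.
Qed.

Lemma tiles_upright_widen m w h : 0 < w -> h < m ->
  tiles_para w h -> tiles_upright m h -> tiles_upright (w + m) h.
Proof.
move=> w0 hm Pw Tm x y.
apply: (@tileable_cut _ _ 1 (-1) (x + w - y) _ (para x y w h)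
  (upright (x + w) y m h)) => //.
- by rewrite sqrrN !expr1n addr_gt0.
- by cut_by_line.
- by cut_by_line.
Qed.

Lemma tiles_upright_stack m h h' : 0 < h -> 0 < h' ->
  tiles_upright (m + h') h -> tiles_upright (m - h) h' -> tiles_upright m (h + h').
Proof.
move=> h0 h'0 Th Th' x y.
apply: (@tileable_cut _ _ 0 1 (y + h) _ (upright x y (m + h') h)
  (upright (x + h) (y + h) (m - h) h')) => //.
- by cut_by_line.
- by cut_by_line.
Qed.

Lemma tiles_para_mulw w h k : 0 < w ->
  tiles_para w h -> tiles_para (k.+1%:R * w) h.
Proof.
move=> w0 Pw; elim: k => [|k IH]; first by rewrite mul1r.
by rewrite mulrS mulrDl mul1r; apply: tiles_para_addw; rewrite ?mulr_gt0.
Qed.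

Lemma tiles_para_mulh w h k : 0 < h ->
  tiles_para w h -> tiles_para w (k.+1%:R * h).
Proof.
move=> h0 Pw; elim: k => [|k IH]; first by rewrite mul1r.
by rewrite mulrS mulrDl mul1r; apply: tiles_para_addh; rewrite ?mulr_gt0.
Qed.

(** A grid of [j.+1] rows and [k.+1] columns of parallelograms of height
    [h / j.+1], each consisting of two tiles. *)
Lemma tiles_para_commensurable w h j k : 0 < h ->
  j.+1%:R * w = k.+1%:R * (2 * a * h) -> tiles_para w h.
Proof.
move=> h0 jk.
have j0 : j.+1%:R != 0 :> R by rewrite pnatr_eq0.
have h'0 : 0 < h / j.+1%:R by rewrite divr_gt0.
have -> : w = k.+1%:R * (2 * a * (h / j.+1%:R)).
  by apply: (mulfI j0); rewrite jk; field.
suff: tiles_para (k.+1%:R * (2 * a * (h / j.+1%:R))) (j.+1%:R * (h / j.+1%:R)).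
  by rewrite [j.+1%:R * _]mulrC divfK.
have a0 : 0 < 2 * a * (h / j.+1%:R).
  by apply: mulr_gt0 => //; rewrite mulr_gt0 // (lt_trans ltr01).
apply: tiles_para_mulh => //; apply: tiles_para_mulw => //.
exact: tiles_para_base.
Qed.

Lemma rational_ratio x : rational x -> 0 < x ->
  exists j k : nat, j.+1%:R * x = k.+1%:R.
Proof.
move=> /rationalP[i [n ->]].
case: n => [|n]; first by rewrite invr0 mulr0 ltxx.
rewrite pmulr_lgt0 ?invr_gt0 // ltr0z; case: i => [[|k]|//] // _.
by exists n, k; rewrite mulrC divfK // pnatr_eq0.
Qed.

Hypothesis a_rat : rational a.

(** Cut off a parallelogram of width [m - h * a]; what remains is a scaled tile. *)
Lemma tiles_upright_rational m h : 0 < h -> h * a <= m -> rational (m / h) ->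
  tiles_upright m h.
Proof.
move=> h0; rewrite le_eqVlt => /orP[/eqP <- _|ham]; first exact: tiles_upright_base.
case: a_rat => qa _ qaE [qm _ qmE].
have -> : m = (m - h * a) + h * a by rewrite subrK.
have w0 : 0 < m - h * a by rewrite subr_gt0.
apply: tiles_upright_widen => //; first by rewrite ltr_pMr.
  have [] := @rational_ratio ((m - h * a) / (2 * a * h)).
  - exists ((qm - qa) / (2 * qa)) => //.
    rewrite fmorph_div /= rmorphB rmorphM /= qaE qmE rmorph_nat; field.
    by rewrite ?mulf_neq0 ?gt_eqF // (lt_trans ltr01).
  - by rewrite divr_gt0 // !mulr_gt0 // (lt_trans ltr01).
  - move=> j [k jk]; apply: (@tiles_para_commensurable _ _ j k) => //.
    rewrite -jk; field.
    by rewrite ?mulf_neq0 ?gt_eqF // (lt_trans ltr01).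
exact: tiles_upright_base.
Qed.

(** The topmost strip has midline [m - j%:R * k], the smallest of all; the
    hypothesis says that it is at least as elongated as the tile. *)
Lemma tiles_upright_strips k j m : 0 < k -> k * a <= m - j%:R * k ->
  rational (m / k) -> tiles_upright m (j.+1%:R * k).
Proof.
move=> k0; elim: j m => [|j IH] m mk m_rat.
  by rewrite mul1r; apply: tiles_upright_rational => //; lra.
case: m_rat => q _ qE.
have jk0 : 0 <= j%:R * k by rewrite mulr_ge0 // ltW.
rewrite mulrS mulrDl mul1r; apply: tiles_upright_stack; rewrite ?mulr_gt0 //.
  apply: tiles_upright_rational => //; first by rewrite -natr1 in mk *; lra.
  exists (q + j.+1%:R) => //; rewrite rmorphD rmorph_nat /= qE; field.
  by rewrite gt_eqF.
apply: IH; first by rewrite -natr1 in mk; lra.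
by exists (q - 1) => //; rewrite rmorphB rmorph1 /= qE; field; rewrite gt_eqF.
Qed.

Lemma tiles_upright_unit b : 1 < b -> rational b -> tiles_upright b 1.
Proof.
move=> b1 [q _ qE].
(* The top one of [N.+1] strips has midline [b - N%:R / N.+1%:R], and this is at
   least [a / N.+1%:R] for large [N], because [b > 1]. *)
have [N Nb] : exists N : nat, a < N.+1%:R * (b - 1).
  exists (Num.bound (a / (b - 1))).
  rewrite -ltr_pdivrMr ?subr_gt0 //; apply: lt_trans (archi_boundP _) _.
    by rewrite divr_ge0 // ?subr_ge0 ltW // (lt_trans ltr01).
  by rewrite ltr_nat.
have N0 : N.+1%:R != 0 :> R by rewrite pnatr_eq0.
have Npos : 0 < N.+1%:R^-1 :> R by rewrite invr_gt0.
rewrite -(mulfV N0); apply: tiles_upright_strips => //.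
  have -> : b - N%:R * N.+1%:R^-1 = N.+1%:R^-1 * (N.+1%:R * (b - 1) + 1).
    by rewrite -natr1 in N0 *; field.
  by rewrite ler_pM2l //; lra.
by exists (q * N.+1%:R) => //; rewrite rmorphM rmorph_nat /= qE invrK.
Qed.

End Construction.

(** * Rotations and translations *)

Section Transport.
Context {R : realType}.
Implicit Types (e c v z : R * R) (A B : set (R * R)).

Lemma homothetic_trans A B C : homothetic A B -> homothetic B C -> homothetic A C.
Proof.
move=> [k [v [k0 ->]]] [l [w [l0 ->]]]; exists (l * k), (l *: v + w).
split; first by rewrite mulf_neq0.
rewrite image_comp; apply: eq_imagel => z _ /=.
by rewrite scalerDr scalerA addrA.
Qed.

Lemma homothetic_translate A v : homothetic A [set z + v | z in A].
Proof.
exists 1, v; split; first exact: oner_neq0.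
by apply: eq_imagel => z _; rewrite scale1r.
Qed.

(** The shape [A] of the tiles may be replaced by a homothetic one; so the two
    trapezoids can be translated independently. *)
Lemma tileable_homothetic A A' B : homothetic A' A ->
  tileable_by_homothets A B -> tileable_by_homothets A' B.
Proof.
move=> A'A [n [T [TB TA]]]; exists n, T; split=> // i.
exact: homothetic_trans (TA i).
Qed.

Lemma tileable_image (phi : R * R -> R * R) A B :
  continuous phi -> injective phi ->
  (forall k v, exists v', forall z, phi (k *: z + v) = k *: phi z + v') ->
  tileable_by_homothets A B -> tileable_by_homothets (phi @` A) (phi @` B).
Proof.
move=> phi_cont phi_inj phi_homo [n [T [[TB triv] TA]]].
exists n, (fun i => phi @` T i); split; first split.
- by rewrite TB image_bigcup.
- have int i z : interior (phi @` T i) z -> exists2 w, interior (T i) w & phi w = z.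
    move=> zi; have [w wi wz] := interior_subset zi; exists w => //.
    rewrite -wz in zi; have : nbhs w (phi @^-1` (phi @` T i)) := phi_cont w _ zi.
    by apply: filterS => t [t' t'T /phi_inj <-].
  move=> i j _ _ [z [/int[w wi wz] /int[w' w'j w'z]]].
  apply: triv => //; exists w; split=> //.
  by rewrite (_ : w = w') //; apply: phi_inj; rewrite wz.
- move=> i; have [k [v [k0 ->]]] := TA i; have [v' phiE] := phi_homo k v.
  exists k, v'; split=> //; rewrite !image_comp.
  by apply: eq_imagel => z _ /=; rewrite phiE.
Qed.

(** Multiplication by [e] in the complex plane; a rotation if [e] is a unit vector. *)
Definition turn e z : R * R := (e.1 * z.1 - e.2 * z.2, e.2 * z.1 + e.1 * z.2).

Definition mirror e : R * R := (e.1, - e.2).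

Definition unit_vector e := e.1 ^+ 2 + e.2 ^+ 2 = 1.

Lemma turnK e : unit_vector e -> cancel (turn e) (turn (mirror e)).
Proof.
move=> e1 [x y]; rewrite /turn /=; congr pair.
  by rewrite -[RHS]mul1r -e1; ring.
by rewrite -[RHS]mul1r -e1; ring.
Qed.

Lemma turnKV e : unit_vector e -> cancel (turn (mirror e)) (turn e).
Proof.
move=> e1 [x y]; rewrite /turn /=; congr pair.
  by rewrite -[RHS]mul1r -e1; ring.
by rewrite -[RHS]mul1r -e1; ring.
Qed.

Lemma turn_mirror e : unit_vector e -> unit_vector (mirror e).
Proof. by rewrite /unit_vector /= sqrrN. Qed.

Lemma turnD e z v : turn e (z + v) = turn e z + turn e v.
Proof. by rewrite /turn /=; congr pair => /=; ring. Qed.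

Lemma turnN e z : turn e (- z) = - turn e z.
Proof. by rewrite /turn /=; congr pair => /=; ring. Qed.

Lemma turnZ e (k : R) z : turn e (k *: z) = k *: turn e z.
Proof. by rewrite /turn; congr pair; rewrite /= /GRing.scale /=; ring. Qed.

Lemma tileable_rigid e c A B : unit_vector e -> tileable_by_homothets A B ->
  tileable_by_homothets [set turn e z + c | z in A] [set turn e z + c | z in B].
Proof.
move=> e1; apply: tileable_image.
- have -> : (fun z => turn e z + c) =
     (fun z => (e.1 * z.1 + (- e.2) * z.2 + c.1, e.2 * z.1 + e.1 * z.2 + c.2)).
    by apply/funext => w; rewrite /turn; congr pair => /=; ring.
  move=> z; exact: cvg_pair (@continuous_affine R e.1 (- e.2) c.1 z)
    (@continuous_affine R e.2 e.1 c.2 z).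
- by move=> z w /addIr /(can_inj (turnK e1)).
- move=> k v; exists (turn e v + c - k *: c) => z.
  rewrite turnD turnZ scalerDr -!addrA; congr (_ + _).
  by rewrite [RHS]addrC -!addrA addNr addr0 addrC.
Qed.

End Transport.

(** * Trapezoids in standard position *)

Section StandardPosition.
Context {R : realType}.
Implicit Types (e c u v z : R * R).

Lemma sqr_eq1_sign (x : R) : x ^+ 2 = 1 -> is_sign x.
Proof. by move=> /eqP; rewrite sqrf_eq1 => /orP[] /eqP ->; [left|right]. Qed.

Lemma dot_turn e u v : unit_vector e -> dot (turn e u) (turn e v) = dot u v.
Proof. by move=> e1; rewrite -[RHS]mul1r -e1 /dot /turn /=; ring. Qed.

Lemma cross_turn e u v : unit_vector e -> cross (turn e u) (turn e v) = cross u v.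
Proof. by move=> e1; rewrite -[RHS]mul1r -e1 /cross /turn /=; ring. Qed.

Lemma length_horizontal e (x : R) : unit_vector e -> length (turn e (x, 0)) = `|x|.
Proof.
by move=> e1; rewrite /length dot_turn // /dot /= mulr0 addr0 -expr2 sqrtr_sqr.
Qed.

Lemma cos_pi4 : 0 < cos (pi / 4 : R) /\ 2 * cos (pi / 4 : R) ^+ 2 = 1.
Proof.
have p0 := pi_gt0 R; split; first by apply: cos_gt0_pihalf; apply/andP; split; lra.
have : cos (pi / 4 *+ 2 : R) = 0 by rewrite -[RHS](cos_pihalf R); congr cos; lra.
by rewrite cos_mulr2n -mulr_natl; lra.
Qed.

(** Squaring gives a polynomial condition on the cosine of the angle; its sign is
    retained. The Cauchy-Schwarz inequality puts the argument of [acos] in the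
    interval where [acos] is an inverse of [cos]. *)
Lemma angle_pi4 u v : 0 < dot u u -> 0 < dot v v -> angle u v = pi / 4 ->
  0 < dot u v /\ 2 * dot u v ^+ 2 = dot u u * dot v v.
Proof.
move=> u0 v0 ang; have [c0 c2] := cos_pi4.
have lu : 0 < length u by rewrite sqrtr_gt0.
have lv : 0 < length v by rewrite sqrtr_gt0.
have lu2 : length u ^+ 2 = dot u u by rewrite sqr_sqrtr // ltW.
have lv2 : length v ^+ 2 = dot v v by rewrite sqr_sqrtr // ltW.
have CS : dot u v ^+ 2 <= (length u * length v) ^+ 2.
  rewrite exprMn lu2 lv2 -subr_ge0.
  have -> : dot u u * dot v v - dot u v ^+ 2 = cross u v ^+ 2.
    by rewrite /dot /cross; ring.
  exact: sqr_ge0.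
have luv : 0 < length u * length v by rewrite mulr_gt0.
have dE : dot u v = cos (pi / 4) * (length u * length v).
  rewrite -ang /angle acosK ?divfK ?gt_eqF // in_itv /= -ler_norml.
  rewrite normrM normfV (gtr0_norm luv) ler_pdivrMr // mul1r.
  by rewrite -(ger0_norm (ltW luv)) -ler_sqr ?nnegrE // !real_normK ?num_real.
split; first by rewrite dE mulr_gt0.
rewrite dE -lu2 -lv2; set k := cos _ in c2 *.
have -> : 2 * (k * (length u * length v)) ^+ 2 =
  (2 * k ^+ 2) * (length u ^+ 2 * length v ^+ 2) by ring.
by rewrite c2 mul1r.
Qed.

Lemma sum4 (V : zmodType) (F : 'I_4 -> V) : \sum_i F i = F 0 + F 1 + F 2 + F 3.
Proof.
rewrite !big_ord_recl big_ord0 addr0 !addrA.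
by congr (_ + F _ + F _ + F _); apply/val_inj.
Qed.

Lemma region_turn e c (p P : 'I_4 -> R * R) : (forall i, p i = turn e (P i) + c) ->
  region p = [set turn e z + c | z in region P].
Proof.
move=> pE; rewrite /region image_comp; apply: eq_imagel => t [_ t1] /=.
rewrite (big_morph (turn e) (turnD e) (id1 := 0) (op1 := +%R)); last first.
  by rewrite /turn /= !mulr0 subr0 addr0.
rewrite -[X in _ + X]scale1r -t1 scaler_suml -big_split /=.
by apply: eq_bigr => i _; rewrite turnZ -scalerDr pE.
Qed.

(** The vertices [0] and [1] are at the larger base, at height [- s / 2]. The sign
    [g] tells whether the larger base goes to the right from vertex [0]. *)
Lemma region_standard (P : 'I_4 -> R * R) (a g s : R) :
  1 < a -> is_sign g -> is_sign s ->
  P 0 = (- (g * (a + 1)) / 2, - s / 2) -> P 1 = (g * (a + 1) / 2, - s / 2) ->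
  P 2 = (g * (a - 1) / 2, s / 2) -> P 3 = (- (g * (a - 1)) / 2, s / 2) ->
  region P = trap 0 a 1 s.
Proof.
move=> a1 g1 s1 P0 P1 P2 P3.
have gg : g * g = 1 by case: g1 => ->; rewrite ?mulrNN mulr1.
have ss : s * s = 1 by case: s1 => ->; rewrite ?mulrNN mulr1.
apply/seteqP; split=> [_ [t [t0 t1] <-]|[x y]].
  move: (t0 0) (t0 1) (t0 2) (t0 3) t1; rewrite !sum4 P0 P1 P2 P3.
  rewrite /trap /= /GRing.scale /= !subr0.
  move: (t 0) (t 1) (t 2) (t 3) => t_0 t_1 t_2 t_3 h0 h1 h2 h3 t1.
  have h03 : 0 <= t_3 * (a - 1) by rewrite mulr_ge0 // subr_ge0 ltW.
  have h02 : 0 <= t_2 * (a - 1) by rewrite mulr_ge0 // subr_ge0 ltW.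
  have h00 : 0 <= t_0 * (a + 1) by rewrite mulr_ge0 //; lra.
  have h01 : 0 <= t_1 * (a + 1) by rewrite mulr_ge0 //; lra.
  split; first by rewrite ler_norml; case: s1 => ->; apply/andP; split; lra.
  rewrite -lerBrDr ler_norml.
  by case: s1 => ->; case: g1 => ->; apply/andP; split; nra.
rewrite /trap /= !subr0 => -[].
rewrite -lerBrDr !ler_norml => /andP[y1 y2] /andP[x1 x2].
(* A point of the trapezoid has bilinear coordinates: [tau] is its relative
   distance from the larger base, [xi] its relative position within its horizontal
   slice, whose length is [2 * W]. *)
pose tau := s * y + 1 / 2.
pose W := (a + 1) / 2 - tau.
have tau0 : 0 <= tau by rewrite /tau; case: s1 => ->; lra.
have tau1 : tau <= 1 by rewrite /tau; case: s1 => ->; lra.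
have W0 : 0 < W by rewrite /W; lra.
pose xi := (g * x / W + 1) / 2.
have /andP[xi1 xi2] : - 1 <= g * x / W <= 1.
  rewrite ler_pdivrMr // ler_pdivlMr //; apply/andP; rewrite /W /tau.
  by case: g1 => ->; split; lra.
have xi0 : 0 <= xi by rewrite /xi; lra.
have {xi2}xi1 : xi <= 1 by rewrite /xi; lra.
exists (fun i : 'I_4 => nth 0
  [:: (1 - tau) * (1 - xi); (1 - tau) * xi; tau * xi; tau * (1 - xi)] i).
  split; last by rewrite sum4 /=; ring.
  by case=> [[|[|[|[|//]]]]] /= _; rewrite mulr_ge0 // subr_ge0.
rewrite sum4 P0 P1 P2 P3 /=; congr pair; rewrite /= /GRing.scale /=.
  have xE : x = g * (2 * xi - 1) * W.
    transitivity (g * g * x); first by rewrite gg mul1r.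
    by rewrite /xi; field; rewrite gt_eqF.
  by rewrite xE /W; field.
transitivity (s * s * y); last by rewrite ss mul1r.
by rewrite /tau; field.
Qed.

(** In coordinates along [e] with origin at vertex [0], the vertices are [(0, 0)],
    [(S, 0)], [(X2, y)] and [(X3, y)]. The height gives [y ^+ 2 = 1], the two
    angles give that [X3] and [S - X2] are both the sign of [S], and convexity
    gives [`|S| > 2]. *)
Lemma region_trap e (p : 'I_4 -> R * R) (a : R) : unit_vector e -> trapezoid p ->
  parallel e (side p 0) -> parallel e (side p 2) -> height p = 1 ->
  vertex_angle p 0 = pi / 4 -> vertex_angle p 1 = pi / 4 -> midline p = a ->
  exists s c, [/\ is_sign s, 1 < a &
    region p = [set turn e z + c | z in trap 0 a 1 s]].
Proof.
move=> e1 [conv _ _ _] par0 par2 hp1 ang0 ang1 mid.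
have E01 : 0 + 1 = 1 :> 'I_4 by apply/val_inj.
have E11 : 1 + 1 = 2 :> 'I_4 by apply/val_inj.
have E21 : 2 + 1 = 3 :> 'I_4 by apply/val_inj.
have E31 : 3 + 1 = 0 :> 'I_4 by apply/val_inj.
have E0B : 0 - 1 = 3 :> 'I_4 by apply/val_inj.
have E1B : 1 - 1 = 0 :> 'I_4 by apply/val_inj.
pose P i := turn (mirror e) (p i - p 0).
have pE i : p i = p 0 + turn e (P i) by rewrite turnKV // addrC subrK.
have pB i j : p i - p j = turn e (P i - P j).
  by rewrite (pE i) (pE j) turnD turnN opprD addrACA subrr add0r.
have P0 : P 0 = 0 by rewrite /P subrr /turn /= !mulr0 addr0 subr0.
have P1 : (P 1).2 = 0.
  move: par0; rewrite /parallel /side E01 => par0.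
  by rewrite /P /turn /= -[RHS]par0 /cross /=; ring.
have P23 : (P 3).2 = (P 2).2.
  move: par2; rewrite /parallel /side E21 => par2.
  apply/eqP; rewrite -subr_eq0; apply/eqP.
  by rewrite /P /turn /= -[RHS]par2 /cross /=; ring.
(* From now on only the relations just proved are used, not the formula for [P]. *)
clearbody P.
have [S P1E] : exists S, P 1 = (S, 0).
  by exists (P 1).1; rewrite [LHS]surjective_pairing P1.
have [X2 [y P2E]] : exists X2 y, P 2 = (X2, y).
  by exists (P 2).1, (P 2).2; exact: surjective_pairing.
have [X3 P3E] : exists X3, P 3 = (X3, y).
  by exists (P 3).1; rewrite [LHS]surjective_pairing P23 P2E.
have y0 : y != 0.
  apply/eqP => y0; have := conv 0 0.
  by rewrite /side E01 E11 !pB !cross_turn // P0 P1E P2E y0 /cross /=; nra.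
have S0 : S != 0.
  apply/eqP => S0; have := conv 0 0.
  by rewrite /side E01 E11 !pB !cross_turn // P0 P1E P2E S0 /cross /=; nra.
have conv02 := conv 0 2.
rewrite /side E01 E11 E21 E31 !pB !cross_turn // P0 P1E P2E P3E /cross /= in conv02.
have y1 : y ^+ 2 = 1.
  suff hE : height p = `|y| by rewrite -[LHS]real_normK ?num_real // -hE hp1 expr1n.
  pose dists :=
    [set length (x - y) | x in line (p 0) (p 1) & y in line (p 2) (p 3)].
  have attained : dists `|y|.
    (* The vertex [3] and the foot of the perpendicular from it. *)
    exists (p 0 + (X3 / S) *: (p 1 - p 0)); first by exists (X3 / S).
    exists (p 3); first by exists 1 => //; rewrite scale1r addrC subrK.
    rewrite pB [p 0 + _]addrC -addrA pB -turnZ -turnD /length dot_turn //.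
    rewrite P0 P1E P3E.
    by rewrite -sqrtr_sqr; congr Num.sqrt; rewrite /dot /= /GRing.scale /=; field.
  have lower : lbound dists `|y|.
    move=> _ [_ [t _ <-] [_ [t' _ <-] <-]].
    have -> : p 0 + t *: (p 1 - p 0) - (p 2 + t' *: (p 3 - p 2)) =
       (p 0 - p 2) + (t *: (p 1 - p 0) - t' *: (p 3 - p 2)).
      by rewrite opprD addrACA.
    rewrite !pB -!turnZ -turnN -!turnD /length dot_turn // P0 P1E P2E P3E.
    rewrite -sqrtr_sqr ler_wsqrtr // /dot /= /GRing.scale /=.
    set q := (_ + _ : R).
    have -> : 0 - y + (t * (0 - 0) - t' * (y - y)) = - y by ring.
    by rewrite mulrNN -[y * y]expr2 lerDr -[q * q]expr2 sqr_ge0.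
  apply/eqP; rewrite eq_le; apply/andP; split.
    by apply: ge_inf attained; exists `|y|.
  by apply: lb_le_inf lower; exists `|y|.
have [d0 d0E] : 0 < S * X3 /\ 2 * (S * X3) ^+ 2 = S ^+ 2 * (X3 ^+ 2 + 1).
  move: ang0; rewrite /vertex_angle E01 E0B !pB P0 P1E P3E !subr0.
  move/angle_pi4; rewrite !dot_turn // /dot /= mulr0 addr0 -!expr2 y1.
  rewrite mul0r addr0; apply.
    by rewrite exprn_even_gt0.
  by rewrite ltr_wpDl ?sqr_ge0.
have [d1 d1E] : 0 < (X2 - S) * - S /\
    2 * ((X2 - S) * - S) ^+ 2 = ((X2 - S) ^+ 2 + 1) * S ^+ 2.
  move: ang1; rewrite /vertex_angle E11 E1B !pB P0 P1E P2E.
  move/angle_pi4; rewrite !dot_turn // /dot /= !subr0 !sub0r.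
  rewrite ?oppr0 ?mulr0 ?addr0 ?mulrNN -!expr2 y1; apply.
    by rewrite ltr_wpDl ?sqr_ge0.
  by rewrite exprn_even_gt0.
have SS0 : S ^+ 2 != 0 by rewrite expf_neq0.
have g1 : is_sign X3.
  by apply/sqr_eq1_sign/(mulfI SS0); lra.
have X2E : X2 = S - X3.
  have : is_sign (X2 - S).
    by apply/sqr_eq1_sign/(mulfI SS0); lra.
  by case=> E; case: g1 d0 d1 => ->; rewrite E; lra.
have s1 : is_sign y := sqr_eq1_sign y1.
have SX : 0 < S * (S - 2 * X3).
  by move: conv02; rewrite X2E; case: s1 => ->; lra.
have mE : (`|S| + `|2 * X3 - S|) / 2 = a.
  rewrite -mid /midline /side E01 E21 !pB P0 P1E P2E P3E X2E.
  have -> : (S, 0) - 0 = (S, 0) :> R * R by rewrite subr0.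
  have -> : (X3, y) - (S - X3, y) = (2 * X3 - S, 0).
    by congr pair => /=; ring.
  by rewrite !length_horizontal.
have [a1 aE] : 1 < a /\ S = X3 * (a + 1).
  case: g1 d0 SX mE => ->.
    rewrite mulr1 => S_gt0; rewrite pmulr_rgt0 // => S2.
    by rewrite gtr0_norm // ltr0_norm; [split|]; lra.
  rewrite mulrN1 oppr_gt0 => S_lt0; rewrite nmulr_rgt0 // => S2.
  by rewrite ltr0_norm // gtr0_norm; [split|]; lra.
exists y, (p 0 + turn e (S / 2, y / 2)); split=> //.
pose P' i := P i - (S / 2, y / 2).
rewrite (@region_turn e (p 0 + turn e (S / 2, y / 2)) p P'); last first.
  by move=> i; rewrite pE addrCA -turnD subrK.
by rewrite (@region_standard P' a X3 y) // /P' ?P0 ?P1E ?P2E ?P3E;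
  congr pair => /=; rewrite ?X2E ?aE; field.
Qed.

End StandardPosition.

Lemma tileable_of_rational (R : realType) (a b s s0 : R) :
  is_sign s -> is_sign s0 -> 1 < a -> 1 < b -> rational a -> rational b ->
  tileable_by_homothets (trap 0 a 1 s) (trap 0 b 1 s0).
Proof.
move=> s1 s01 a1 b1 a_rat b_rat.
have up s' : is_sign s' -> tileable_by_homothets (trap 0 a 1 s') (trap 0 b 1 1).
  move=> s'1; have := @tiles_upright_unit R a s' a1 s'1 a_rat b b1 b_rat
    (- (b + 1) / 2) (- 1 / 2).
  rewrite uprightE; congr (tileable_by_homothets _ (trap _ _ _ _)).
  by congr pair => /=; field.
case: s01 => ->; first exact: up.
have sN : is_sign (- s) by case: s1 => ->; rewrite ?opprK; [right|left].
have e1 : @unit_vector R (-1, 0).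
  by rewrite /unit_vector /= sqrrN expr1n expr0n addr0.
have := tileable_rigid 0 e1 (up _ sN).
(* The half-turn exchanges the two orientations of a trapezoid. *)
have flip m t :
    [set turn (-1, 0) z + 0 | z in trap 0 m 1 t] = trap (0 : R * R) m 1 (- t).
  have := @homothet_trap R (-1) 0 0 m 1 t; rewrite oppr_eq0 oner_neq0 => /(_ isT).
  rewrite normrN normr1 !mul1r sgrN sgr1 mulN1r scaler0 addr0 => <-.
  apply: eq_imagel => z _; rewrite !addr0 /turn scaleN1r.
  by congr pair => /=; ring.
by rewrite !flip opprK.
Qed.

(** * The theorem *)

Theorem mainTheorem1 (R : realType) (u : R * R) (p q : 'I_4 -> R * R) (a b : R)
    (u_neq0 : u != 0)
    (trap_p : trapezoid p) (trap_q : trapezoid q)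
    (bases_p : parallel u (side p 0) /\ parallel u (side p 2))
    (bases_q : parallel u (side q 0) /\ parallel u (side q 2))
    (height_p : height p = 1) (height_q : height q = 1)
    (angles_p : vertex_angle p 0 = pi / 4 /\ vertex_angle p 1 = pi / 4)
    (angles_q : vertex_angle q 0 = pi / 4 /\ vertex_angle q 1 = pi / 4)
    (midline_p : midline p = a) (midline_q : midline q = b)
    (a_rat : rational a) :
  tileable_by_homothets (region p) (region q) <-> rational b.
Proof.
(* The rotation by which both trapezoids leave the standard position takes
   the first axis to the direction of [u]. *)
have [e e1 ue] : exists2 e, unit_vector e & forall v, parallel u v -> parallel e v.
  have u0 : 0 < dot u u.
    rewrite /dot -!expr2 lt_neqAle addr_ge0 ?sqr_ge0 // andbT eq_sym.
    rewrite paddr_eq0 ?sqr_ge0 // !sqrf_eq0; apply: contra u_neq0.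
    by case: (u) => x y /= /andP[/eqP -> /eqP ->].
  have l0 : length u != 0 by rewrite sqrtr_eq0 -ltNge.
  have lE : length u ^+ 2 = dot u u by rewrite sqr_sqrtr // ltW.
  exists (u.1 / length u, u.2 / length u).
    rewrite /unit_vector /= !expr_div_n -mulrDl lE !expr2 divff //.
    by rewrite gt_eqF.
  move=> v; rewrite /parallel /cross /= => uv.
  by rewrite ![_ / length u * _]mulrAC -mulrBl uv mul0r.
have [s [c [s1 a1 ->]]] := region_trap e1 trap_p (ue _ bases_p.1) (ue _ bases_p.2)
  height_p angles_p.1 angles_p.2 midline_p.
have [s0 [d [s01 b1 ->]]] := region_trap e1 trap_q (ue _ bases_q.1) (ue _ bases_q.2)
  height_q angles_q.1 angles_q.2 midline_q.
split=> [tiled|b_rat].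
- apply: (rational_of_tileable s1 s01 a1 b1 a_rat).
  have := tileable_rigid (- turn (mirror e) d) (turn_mirror e1) tiled.
  rewrite !image_comp.
  have -> : [set ((fun z => turn (mirror e) z - turn (mirror e) d) \o
      (fun z => turn e z + d)) z | z in trap 0 b 1 s0] = trap 0 b 1 s0.
    rewrite -[RHS]image_id; apply: eq_imagel => z _ /=.
    by rewrite turnD addrK turnK.
  apply: tileable_homothetic.
  have -> : [set ((fun z => turn (mirror e) z - turn (mirror e) d) \o
      (fun z => turn e z + c)) z | z in trap 0 a 1 s] =
      [set z + (turn (mirror e) c - turn (mirror e) d) | z in trap 0 a 1 s].
    by apply: eq_imagel => z _ /=; rewrite turnD turnK // addrA.
  exact: homothetic_translate.
- have := tileable_rigid d e1 (tileable_of_rational s1 s01 a1 b1 a_rat b_rat).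
  apply: tileable_homothetic.
  have -> : [set turn e z + d | z in trap 0 a 1 s] =
      [set z + (d - c) | z in [set turn e z + c | z in trap 0 a 1 s]].
    by rewrite image_comp; apply: eq_imagel => z _ /=; rewrite addrACA subrr addr0.
  exact: homothetic_translate.
Qed.
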